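(* There exist an absolute constant $C>0$ and an algorithm (Find-One-Unknown) with the following guarantee. Let $n\ge27$, $m\ge2$, $\varepsilon\in(0,1)$, let $P,Q$ be unknown distributions on $[n]$ with $\mathrm{d_{TV}}(P,Q)\ge\varepsilon$, and let $D_1,\dots,D_m$ be distributions on $[n]$ such that for an unknown set $\chi\subseteq[m]$ with $1\in\chi$, $D_i=P$ for $i\in\chi$ and $D_i=Q$ for $i\in[m]\setminus\chi$. Given sample access to the $D_i$ and $n,m,\varepsilon$, with probability at least $2/3$ the algorithm returns ''All Identical'' if $\chi=[m]$, and returns an index $j\in[m]\setminus\{1\}$ with $D_j\neq D_1$ if $\chi\neq[m]$. Its sample complexity is at most $$C\max\left(\left(\frac{nm}{\varepsilon^2}\right)^{2/3},\frac{m\sqrt n}{\varepsilon^2}\right)\log m.$$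
   Context: $\mathrm{d_{TV}}$ is total variation distance. Sample access means the algorithm may adaptively request independent samples from any $D_i$; sample complexity is the total number of samples drawn. *)

(* Defs.v *)
From HB Require Import structures.
From mathcomp Require Import all_boot all_order all_algebra.
From mathcomp Require Import all_classical all_reals all_analysis.
Set Implicit Arguments. Unset Strict Implicit. Unset Printing Implicit Defensive.
Import Order.TTheory GRing.Theory Num.Theory.
Local Open Scope ring_scope.

Definition is_dist (R : realType) (n : nat) (p : {ffun 'I_n -> R}) : Prop :=
  (forall x, 0 <= p x) /\ \sum_(x < n) p x = 1.

Definition dTV (R : realType) (n : nat) (p q : {ffun 'I_n -> R}) : R :=
  2^-1 * \sum_(x < n) `|p x - q x|.

(* A randomized adaptive sampling algorithm over m distributions on [n]:
   a (well-founded) decision tree. [Sample i k] draws a fresh independent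
   sample x from D_i and continues with [k x]; [Coin k] flips a fair coin
   (internal randomness); [Ret o] halts with output o, where
   [None] = "All Identical" and [Some j] = index j. *)
Inductive alg (m n : nat) : Type :=
| Ret : option 'I_m -> alg m n
| Sample : 'I_m -> ('I_n -> alg m n) -> alg m n
| Coin : (bool -> alg m n) -> alg m n.

Arguments Ret {m n}.
Arguments Sample {m n}.
Arguments Coin {m n}.

Fixpoint success_prob (R : realType) (m n : nat) (D : 'I_m -> {ffun 'I_n -> R})
  (good : option 'I_m -> bool) (t : alg m n) {struct t} : R :=
  match t with
  | Ret o => if good o then 1 else 0
  | Sample i k =>
      foldr (fun x acc => D i x * success_prob D good (k x) + acc) 0 (enum 'I_n)
  | Coin k => 2^-1 * (success_prob D good (k true) + success_prob D good (k false))
  end.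

Inductive uses_at_most (m n : nat) : nat -> alg m n -> Prop :=
| uam_ret : forall s o, uses_at_most s (Ret o)
| uam_sample : forall s i k, (forall x, uses_at_most s (k x)) ->
    uses_at_most s.+1 (Sample i k)
| uam_coin : forall s k, (forall b, uses_at_most s (k b)) ->
    uses_at_most s (Coin k).

(* Main.v *)
Require Import Defs.
From HB Require Import structures.
From mathcomp Require Import all_boot all_order all_algebra.
From mathcomp Require Import all_classical all_reals all_analysis.
From mathcomp Require Import ring lra zify.
Import Order.TTheory GRing.Theory Num.Theory.
Local Open Scope ring_scope.

(** Draw [K] samples from [D_1] once, and let [w z = 1 / (1 + c z)], where [c z]
    is the number of occurrences of [z] among them.  These weights do the work of
    the flattening of Diakonikolas and Kane: [\sum_z w z * P z ^ 2] is [O(1 / K)]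
    on average, while [\sum_z 1 / w z = n + K] and Cauchy-Schwarz keep the weighted
    squared distance [\sum_z w z * (P z - Q z) ^ 2] above [2 eps ^ 2 / n] when
    [K <= n].  For each [j], a two-sample statistic over pairs [(x, y)] drawn from
    [D_1 x D_j] has [M ^ 2] times this squared distance as its mean, and Chebyshev's
    inequality separates [D_j = P] from [D_j = Q] as soon as [M] is of order
    [n / (sqrt K * eps ^ 2)]; the variance involves the weighted norm of [P] only,
    since [P + Q = 2 P - (P - Q)].  A majority vote over [O(log m)] repetitions and
    a union bound over [j] finish the proof, and [K = min (n, (n m / eps ^ 2) ^ (2/3))]
    balances [K] against [m * M]. *)

(** * Sampling procedures with results of any type, and their worst-case cost *)

Inductive proc (m n : nat) (T : Type) : Type :=
| PRet : T -> proc m n T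
| PSample : 'I_m -> ('I_n -> proc m n T) -> proc m n T.

Arguments PRet {m n T}.
Arguments PSample {m n T}.

Fixpoint pbind {m n T U} (p : proc m n T) (f : T -> proc m n U) : proc m n U :=
  match p with
  | PRet t => f t
  | PSample i k => PSample i (fun x => pbind (k x) f)
  end.

Fixpoint prep {m n T} (k : nat) (p : proc m n T) : proc m n (seq T) :=
  if k is k'.+1 then
    pbind p (fun a => pbind (prep k' p) (fun s => PRet (a :: s)))
  else PRet [::].

Fixpoint alg_of {m n} (p : proc m n (option 'I_m)) : alg m n :=
  match p with
  | PRet o => Ret o
  | PSample i k => Sample i (fun x => alg_of (k x))
  end.

Fixpoint cost_le {m n T} (s : nat) (p : proc m n T) {struct p} : Prop :=
  match p with
  | PRet _ => True
  | PSample _ k => if s is s'.+1 then forall x, cost_le s' (k x) else False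
  end.

Section Cost.
Context {m n : nat}.

Lemma cost_leW {T} (a b : nat) (p : proc m n T) :
  (a <= b)%N -> cost_le a p -> cost_le b p.
Proof.
elim: p a b => [t a b _ _|i k IH a b] /=; first by [].
case: a => [_ []|a]; case: b => [//|b] ab ka x.
exact: IH (ka x).
Qed.

Lemma cost_le_bind {T U} (a b : nat) (p : proc m n T) (f : T -> proc m n U) :
  cost_le a p -> (forall t, cost_le b (f t)) -> cost_le (a + b) (pbind p f).
Proof.
elim: p a => [t a _ fb|i k IH [[]|a ka fb x]]; last exact: IH.
by apply: cost_leW (fb t); rewrite leq_addl.
Qed.

Lemma cost_le_map {T U} (a : nat) (p : proc m n T) (f : T -> U) :
  cost_le a p -> cost_le a (pbind p (fun t => PRet (f t))).
Proof. by move=> pa; rewrite -(addn0 a); apply: cost_le_bind. Qed.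

Lemma cost_le_rep {T} (c k : nat) (p : proc m n T) :
  cost_le c p -> cost_le (k * c) (prep k p).
Proof.
move=> pc; elim: k => [//|k IH] /=; rewrite mulSn; apply: cost_le_bind => // t.
exact: cost_le_map.
Qed.

Lemma uses_alg_of (s : nat) (p : proc m n (option 'I_m)) :
  cost_le s p -> uses_at_most s (alg_of p).
Proof.
elim: p s => [r s ?|i k IH [[]|s H]]; first exact: uam_ret.
by apply: uam_sample => x; apply: IH.
Qed.

End Cost.

(** * Expectations over procedures: linearity, moments, Markov, majority votes *)

Fixpoint Ex {R : realType} {m n T} (D : 'I_m -> {ffun 'I_n -> R})
    (p : proc m n T) (F : T -> R) : R :=
  match p with
  | PRet t => F t
  | PSample i k => \sum_(x < n) D i x * Ex D (k x) F
  end.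

Section Expectation.
Context {R : realType} {m n : nat}.
Variable D : 'I_m -> {ffun 'I_n -> R}.

Lemma success_alg_of (good : option 'I_m -> bool) p :
  success_prob D good (alg_of p) = Ex D p (fun o => (good o)%:R).
Proof.
elim: p => [r|i k IH] /=; first by case: (good r).
rewrite -big_enum /= unlock /=; elim: (enum _) => [//|x e IHe] /=.
by rewrite IHe IH.
Qed.

Lemma eq_Ex {T} (p : proc m n T) F G : F =1 G -> Ex D p F = Ex D p G.
Proof. by move=> /funext ->. Qed.

Lemma Ex_bind {T U} (p : proc m n T) (f : T -> proc m n U) F :
  Ex D (pbind p f) F = Ex D p (fun t => Ex D (f t) F).
Proof. by elim: p => [//|i k IH] /=; apply: eq_bigr => x _; rewrite IH. Qed.

Lemma Ex_repS {T} k (p : proc m n T) F :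
  Ex D (prep k.+1 p) F = Ex D p (fun a => Ex D (prep k p) (fun s => F (a :: s))).
Proof. by rewrite Ex_bind; apply: eq_Ex => a; rewrite Ex_bind. Qed.

Lemma ExD {T} (p : proc m n T) F G :
  Ex D p (fun t => F t + G t) = Ex D p F + Ex D p G.
Proof.
elim: p => [//|i k IH] /=; rewrite -big_split /=.
by apply: eq_bigr => x _; rewrite IH mulrDr.
Qed.

Lemma ExZ {T} (p : proc m n T) c F :
  Ex D p (fun t => c * F t) = c * Ex D p F.
Proof.
elim: p => [//|i k IH] /=; rewrite mulr_sumr.
by apply: eq_bigr => x _; rewrite IH mulrCA.
Qed.

Lemma ExB {T} (p : proc m n T) F G :
  Ex D p (fun t => F t - G t) = Ex D p F - Ex D p G.
Proof.
rewrite -[- Ex D p G]mulN1r -ExZ -ExD.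
by apply: eq_Ex => t; rewrite mulN1r.
Qed.

Lemma Ex_sum {T I} (p : proc m n T) (r : seq I) (F : I -> T -> R) :
  Ex D p (fun t => \sum_(i <- r) F i t) = \sum_(i <- r) Ex D p (F i).
Proof.
elim: r => [|i r IH].
  under eq_Ex do rewrite big_nil -(mul0r 0).
  by rewrite ExZ mul0r big_nil.
under eq_Ex do rewrite big_cons.
by rewrite ExD IH big_cons.
Qed.

(** Fubini for independent procedures: linearity moves [Ex D q] past each sampling step of [p]. *)
Lemma Ex_swap {T U} (p : proc m n T) (q : proc m n U) (F : T -> U -> R) :
  Ex D p (fun t => Ex D q (F t)) = Ex D q (fun u => Ex D p (F^~ u)).
Proof.
elim: p => [//|i k IH] /=; rewrite Ex_sum.
by apply: eq_bigr => x _; rewrite ExZ IH.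
Qed.

Hypothesis distD : forall i, is_dist (D i).

Lemma Ex_cst {T} (p : proc m n T) c : Ex D p (fun=> c) = c.
Proof.
elim: p => [//|i k IH] /=.
under eq_bigr do rewrite IH.
by rewrite -mulr_suml (proj2 (distD i)) mul1r.
Qed.

Lemma le_Ex {T} (p : proc m n T) F G :
  (forall t, F t <= G t) -> Ex D p F <= Ex D p G.
Proof.
move=> FG; elim: p => [//|i k IH] /=; apply: ler_sum => x _.
by apply: ler_wpM2l => //; case: (distD i).
Qed.

(** Monotonicity that may use the length of the sample; the test analysis needs the exact number of
    flattening samples. *)
Lemma le_Ex_rep {T} k (p : proc m n T) F G :
  (forall s, size s = k -> F s <= G s) -> Ex D (prep k p) F <= Ex D (prep k p) G.
Proof.
elim: k F G => [|k IH] F G FG; first exact: FG.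
rewrite !Ex_repS; apply: le_Ex => a; apply: IH => s sk.
by apply: FG; rewrite /= sk.
Qed.

Lemma Ex_rep_sum {T} k (p : proc m n T) (g : T -> R) :
  Ex D (prep k p) (fun s => \sum_(a <- s) g a) = k%:R * Ex D p g.
Proof.
elim: k => [|k IH]; first by rewrite /= big_nil mul0r.
rewrite Ex_repS.
under eq_Ex => a do (under eq_Ex => s do rewrite big_cons; rewrite ExD Ex_cst IH).
by rewrite ExD Ex_cst -natr1; ring.
Qed.

(** Of the [k ^ 2] products in the expanded square, the [k] diagonal ones average to the second
    moment; by independence the others average to the squared mean. *)
Lemma Ex_rep_sum_sqr {T} k (p : proc m n T) (g : T -> R) :
  Ex D (prep k p) (fun s => (\sum_(a <- s) g a) ^+ 2) =
  k%:R * Ex D p (fun a => g a ^+ 2) + (k%:R ^+ 2 - k%:R) * Ex D p g ^+ 2.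
Proof.
elim: k => [|k IH]; first by rewrite /= big_nil expr0n /=; ring.
rewrite Ex_repS.
pose c := k%:R * Ex D p (fun a => g a ^+ 2) + (k%:R ^+ 2 - k%:R) * Ex D p g ^+ 2.
rewrite (@eq_Ex _ p _ (fun a => g a ^+ 2 + (2 * k%:R * Ex D p g) * g a + c)).
  by rewrite 2!ExD Ex_cst ExZ /c -[k.+1%:R]natr1; ring.
move=> a; rewrite (@eq_Ex _ _ _ (fun s => g a ^+ 2 +
  (2 * g a) * (\sum_(b <- s) g b) + (\sum_(b <- s) g b) ^+ 2)).
  by rewrite !ExD Ex_cst ExZ Ex_rep_sum IH /c; ring.
by move=> s; rewrite big_cons; ring.
Qed.

Lemma Ex_rep_prod {T} k (p : proc m n T) (g : T -> R) :
  Ex D (prep k p) (fun s => \prod_(a <- s) g a) = Ex D p g ^+ k.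
Proof.
elim: k => [|k IH]; first by rewrite /= big_nil.
rewrite Ex_repS.
under eq_Ex => a do (under eq_Ex => s do rewrite big_cons; rewrite ExZ IH mulrC).
by rewrite ExZ -exprSr.
Qed.

Lemma markov_Ex {T} (p : proc m n T) F (c : R) (E : pred T) : 0 < c ->
  (forall t, 0 <= F t) -> (forall t, E t -> c <= F t) ->
  Ex D p (fun t => (E t)%:R) <= Ex D p F / c.
Proof.
move=> c0 F0 EF; rewrite mulrC -ExZ; apply: le_Ex => t.
rewrite mulrC ler_pdivlMr //; case: (boolP (E t)) => [/EF|_].
  by rewrite mul1r.
by rewrite mul0r.
Qed.

(* Each wrong vote contributes a factor 4 and each right one a factor 1/4, so
   the product is at least 1 whenever the wrong votes are not a minority. *)
Lemma majority_Ex (k : nat) (p : proc m n bool) (c : bool) :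
  Ex D p (fun b => (b != c)%:R) <= 16^-1 ->
  Ex D (prep k p) (fun s => ((size s <= 2 * count id s)%N != c)%:R) <= 2^-1 ^+ k.
Proof.
move=> err; pose g b : R := 4^-1 + (4 - 4^-1) * (b != c)%:R.
have gE b : g b = if b != c then 4 else 4^-1.
  by rewrite /g; case: (b != c); rewrite ?mulr1 ?mulr0; lra.
(* An error of at most 1/16 gives a mean of at most 1/4 + (15/4)(1/16) = 31/64. *)
have Eg : 0 <= Ex D p g <= 2^-1.
  rewrite ExD Ex_cst ExZ.
  have e0 : 0 <= Ex D p (fun b => (b != c)%:R).
    by rewrite -[X in X <= _](Ex_cst p); apply: le_Ex => b.
  by apply/andP; split; lra.
apply: (@le_trans _ _ (Ex D p g ^+ k)); last first.
  by case/andP: Eg => ? ?; apply: lerXn2r; rewrite ?nnegrE //; lra.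
rewrite -Ex_rep_prod; apply: le_Ex => s.
have pE : \prod_(b <- s) g b =
    4 ^+ count (fun b => b != c) s / 4 ^+ count (fun b => b == c) s.
  elim: s => [|b s IH]; first by rewrite big_nil !expr0 divr1.
  rewrite big_cons IH gE /=; case: (b == c) => /=; rewrite ?add0n ?add1n exprS.
    by rewrite invfM mulrCA.
  by rewrite -mulrA.
have p40 k' : 0 < 4 ^+ k' :> R by rewrite exprn_gt0.
have sz : (count (fun b => b != c) s + count (fun b => b == c) s = size s)%N.
  by rewrite addnC -(count_predC (fun b => b == c)).
have ci : count id s = if c then count (fun b => b == c) s
                      else count (fun b => b != c) s.
  by case: c {err g gE Eg pE sz} => //; apply: eq_count; case.
case: (boolP (_ != c)) => [bad|_]; last first.
  by rewrite pE divr_ge0 // ltW.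
rewrite pE ler_pdivlMr // mul1r; apply: ler_weXn2l; first lra.
by move: bad; rewrite ci -sz; case: (c) => /=; lia.
Qed.

End Expectation.

(** * Moments of a double sum over two independent batches *)

Section DoubleSum.
Context {R : realType} {m n : nat} {T : Type}.
Variable D : 'I_m -> {ffun 'I_n -> R}.
Hypothesis distD : forall i, is_dist (D i).
Variables (p : proc m n T) (h : T -> T -> R) (M : nat).

Lemma Ex_rep_sum2 :
  Ex D (prep M p) (fun s => Ex D (prep M p)
    (fun t => \sum_(a <- s) \sum_(b <- t) h a b)) =
  M%:R ^+ 2 * Ex D p (fun a => Ex D p (h a)).
Proof.
rewrite (@eq_Ex _ _ _ _ _ (prep M p) _ (fun s => \sum_(a <- s) M%:R * Ex D p (h a))).
  by rewrite Ex_rep_sum // ExZ expr2 mulrA.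
by move=> s; rewrite Ex_sum; apply: eq_bigr => a _; rewrite Ex_rep_sum.
Qed.

(** The products [h a b * h a' b'] are sorted by which positions coincide: both, only the first,
    only the second, or neither. Applying [Ex_rep_sum_sqr] to each batch in turn does the count. *)
Lemma Ex_rep_sum2_sqr :
  Ex D (prep M p) (fun s => Ex D (prep M p)
    (fun t => (\sum_(a <- s) \sum_(b <- t) h a b) ^+ 2)) =
  M%:R ^+ 2 * Ex D p (fun a => Ex D p (fun b => h b a ^+ 2)) +
  M%:R * (M%:R ^+ 2 - M%:R) * (Ex D p (fun a => Ex D p (h a) ^+ 2) +
                               Ex D p (fun b => Ex D p (h^~ b) ^+ 2)) +
  (M%:R ^+ 2 - M%:R) ^+ 2 * Ex D p (fun a => Ex D p (h a)) ^+ 2.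
Proof.
rewrite (@eq_Ex _ _ _ _ _ (prep M p) _ (fun s =>
  M%:R * Ex D p (fun b => (\sum_(a <- s) h a b) ^+ 2) +
  (M%:R ^+ 2 - M%:R) * (\sum_(a <- s) Ex D p (h a)) ^+ 2)); last first.
  move=> s; under eq_Ex do rewrite exchange_big /=.
  by rewrite Ex_rep_sum_sqr // Ex_sum.
rewrite ExD !ExZ Ex_rep_sum_sqr // Ex_swap.
under [in LHS]eq_Ex do rewrite Ex_rep_sum_sqr //.
by rewrite ExD !ExZ; ring.
Qed.

End DoubleSum.

(** * The weighted two-sample statistic and its threshold test *)

Definition ppair {m n} (i j : 'I_m) : proc m n ('I_n * 'I_n) :=
  PSample i (fun x => PSample j (fun y => PRet (x, y))).

(** For a pair drawn from [D_i x D_j], an unbiased estimate of [D_i z - D_j z]. *)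
Definition sgn_at {R : realType} {n} (a : 'I_n * 'I_n) (z : 'I_n) : R :=
  (z == a.1)%:R - (z == a.2)%:R.

(* The bilinear form [\sum_z w z * sgn_at a z * sgn_at b z]. *)
Definition kern {R : realType} {n} (w : 'I_n -> R) (a b : 'I_n * 'I_n) : R :=
  w a.1 * sgn_at b a.1 - w a.2 * sgn_at b a.2.

(** Two separate batches are used so that every term pairs independent estimates; no diagonal terms
    bias the mean. *)
Definition pstat {R : realType} {m n} (w : 'I_n -> R) (M : nat) (i j : 'I_m) :
    proc m n R :=
  pbind (prep M (ppair i j)) (fun s => pbind (prep M (ppair i j)) (fun t =>
    PRet (\sum_(a <- s) \sum_(b <- t) kern w a b))).

Definition ptest {R : realType} {m n} (w : 'I_n -> R) (M : nat) (tau : R)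
    (i j : 'I_m) : proc m n bool :=
  pbind (pstat w M i j) (fun u => PRet (tau < u)).

Section Test.
Context {R : realType} {m n : nat}.
Variable D : 'I_m -> {ffun 'I_n -> R}.
Hypothesis distD : forall i, is_dist (D i).
Variables (i j : 'I_m) (w : 'I_n -> R).
Hypothesis w01 : forall z, 0 < w z <= 1.

Let P := D i.
Let Q := D j.
Let del z := P z - Q z.
Let d := \sum_z w z * del z ^+ 2.
Let B := \sum_z w z * P z ^+ 2.

Let P0 z : 0 <= P z. Proof. by case: (distD i). Qed.
Let Q0 z : 0 <= Q z. Proof. by case: (distD j). Qed.
Let w0 z : 0 < w z. Proof. by case/andP: (w01 z). Qed.
Let w1 z : w z <= 1. Proof. by case/andP: (w01 z). Qed.

Lemma Ex_pair_fst (c : 'I_n -> R) :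
  Ex D (ppair i j) (fun a => c a.1) = \sum_z P z * c z.
Proof.
apply: eq_bigr => x _ /=; congr (_ * _).
by rewrite -mulr_suml (proj2 (distD j)) mul1r.
Qed.

Lemma Ex_pair_snd (c : 'I_n -> R) :
  Ex D (ppair i j) (fun a => c a.2) = \sum_z Q z * c z.
Proof. by rewrite /= -mulr_suml (proj2 (distD i)) mul1r. Qed.

Lemma Ex_pairB (c : 'I_n -> R) :
  Ex D (ppair i j) (fun a => c a.1 - c a.2) = \sum_z del z * c z.
Proof.
rewrite ExB Ex_pair_fst Ex_pair_snd -sumrB.
by apply: eq_bigr => z _; rewrite -mulrBl.
Qed.

Lemma Ex_pairB_sqr (c : 'I_n -> R) :
  Ex D (ppair i j) (fun a => (c a.1 - c a.2) ^+ 2) <=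
  2 * \sum_z (P z + Q z) * c z ^+ 2.
Proof.
have -> : 2 * \sum_z (P z + Q z) * c z ^+ 2 =
    Ex D (ppair i j) (fun a => 2 * (c a.1 ^+ 2 + c a.2 ^+ 2)).
  rewrite ExZ ExD (Ex_pair_fst (fun z => c z ^+ 2)).
  rewrite (Ex_pair_snd (fun z => c z ^+ 2)) -big_split /=; congr (_ * _).
  by apply: eq_bigr => z _; rewrite mulrDl.
apply: le_Ex => // a; have := sqr_ge0 (c a.1 + c a.2); nra.
Qed.

Lemma Ex_sgn_at z : Ex D (ppair i j) (sgn_at ^~ z) = del z.
Proof.
rewrite (Ex_pairB (fun x => (z == x)%:R)) (bigD1 z) //= eqxx mulr1.
by rewrite big1 ?addr0 // => x xz; rewrite eq_sym (negbTE xz) mulr0.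
Qed.

Lemma Ex_sgn_at_sqr z :
  Ex D (ppair i j) (fun a => sgn_at a z ^+ 2) <= P z + Q z.
Proof.
have -> : P z + Q z =
    Ex D (ppair i j) (fun a => (z == a.1)%:R + (z == a.2)%:R).
  rewrite ExD (Ex_pair_fst (fun x => (z == x)%:R)).
  rewrite (Ex_pair_snd (fun x => (z == x)%:R)).
  have sel F : \sum_(x < n) F x * (z == x)%:R = F z :> R.
    rewrite (bigD1 z) //= eqxx mulr1 big1 ?addr0 // => x xz.
    by rewrite eq_sym (negbTE xz) mulr0.
  by rewrite !sel.
apply: le_Ex => // a; rewrite /sgn_at.
by case: (z == a.1); case: (z == a.2) => /=; lra.
Qed.

Lemma sum_sgn_at (a : 'I_n * 'I_n) (c : 'I_n -> R) :
  \sum_z c z * sgn_at a z = c a.1 - c a.2.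
Proof.
rewrite /sgn_at; under eq_bigr do rewrite mulrBr.
have sel x : \sum_z c z * (z == x)%:R = c x.
  rewrite (bigD1 x) //= eqxx mulr1 big1 ?addr0 // => z zx.
  by rewrite (negbTE zx) mulr0.
by rewrite sumrB !sel.
Qed.

(** The form is symmetric although [kern] is not written so; [sum_sgn_at] passes between the two
    shapes. Both one-sided averages thus agree. *)
Lemma Ex_kernl b : Ex D (ppair i j) (fun a => kern w a b) =
  w b.1 * del b.1 - w b.2 * del b.2.
Proof.
rewrite (Ex_pairB (fun z => w z * sgn_at b z)).
rewrite -(sum_sgn_at b (fun z => w z * del z)).
by apply: eq_bigr => z _; rewrite mulrA [del z * _]mulrC.
Qed.

Lemma Ex_kernr a : Ex D (ppair i j) (kern w a) =
  w a.1 * del a.1 - w a.2 * del a.2.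
Proof. by rewrite ExB !ExZ !Ex_sgn_at. Qed.

Lemma Ex_kern : Ex D (ppair i j) (fun a => Ex D (ppair i j) (kern w a)) = d.
Proof.
under eq_Ex do rewrite Ex_kernr.
rewrite (Ex_pairB (fun z => w z * del z)).
by apply: eq_bigr => z _; rewrite mulrCA -expr2.
Qed.

(** From [w ^ 2 <= w] and [8 P^2 + 2 (P - Q)^2 - (P + Q)^2 = (3 P - Q)^2]; this removes the weighted
    norm of [Q]. *)
Lemma sqr_sum_bound :
  \sum_z (P z + Q z) * ((P z + Q z) * w z ^+ 2) <= 8 * B + 2 * d.
Proof.
rewrite /B /d !mulr_sumr -big_split /=; apply: ler_sum => z _.
have ww : w z ^+ 2 <= w z by rewrite expr2 ger_pMl.
have sq : (P z + Q z) ^+ 2 <= 8 * P z ^+ 2 + 2 * del z ^+ 2.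
  by rewrite /del; have := sqr_ge0 (3 * P z - Q z); nra.
apply: (@le_trans _ _ ((P z + Q z) ^+ 2 * w z)).
  by rewrite mulrA -expr2; apply: ler_wpM2l => //; exact: sqr_ge0.
apply: (@le_trans _ _ ((8 * P z ^+ 2 + 2 * del z ^+ 2) * w z)).
  by apply: ler_wpM2r => //; exact: ltW.
by lra.
Qed.

(** With [b] fixed, the average over [a] is at most a weighted sum of [sgn_at b z ^ 2], whose own
    average over [b] is at most [P z + Q z]. *)
Lemma Ex_kern_sqr :
  Ex D (ppair i j) (fun b => Ex D (ppair i j) (fun a => kern w a b ^+ 2)) <=
  16 * B + 4 * d.
Proof.
apply: (@le_trans _ _ (Ex D (ppair i j) (fun b =>
    2 * \sum_z ((P z + Q z) * w z ^+ 2) * sgn_at b z ^+ 2))).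
  apply: le_Ex => // b.
  apply: le_trans (Ex_pairB_sqr (fun z => w z * sgn_at b z)) _.
  apply: ler_wpM2l => //; apply: ler_sum => z _.
  by rewrite exprMn mulrA.
rewrite ExZ Ex_sum.
apply: (@le_trans _ _ (2 * (8 * B + 2 * d))); last by lra.
apply: ler_wpM2l => //; apply: le_trans sqr_sum_bound; apply: ler_sum => z _.
rewrite ExZ mulrC; apply: ler_wpM2r; last exact: Ex_sgn_at_sqr.
by apply: mulr_ge0; [apply: addr_ge0 | exact: sqr_ge0].
Qed.

(** As [w z <= 1], [(w z * c z) ^ 2] is at most the single term [w z * c z ^ 2] of the sum. *)
Lemma le_sqrt_weighted_sum (c : 'I_n -> R) z :
  w z * `|c z| <= Num.sqrt (\sum_x w x * c x ^+ 2).
Proof.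
have term x : 0 <= w x * c x ^+ 2 by rewrite mulr_ge0 ?sqr_ge0 ?ltW.
have -> : w z * `|c z| = Num.sqrt ((w z * c z) ^+ 2).
  by rewrite sqrtr_sqr normrM (gtr0_norm (w0 z)).
rewrite ler_sqrt ?sumr_ge0 // (bigD1 z) //=.
apply: (@le_trans _ _ (w z * c z ^+ 2)); last by rewrite lerDl sumr_ge0.
by rewrite exprMn; apply: ler_wpM2r; rewrite ?sqr_ge0 // expr2 ger_pMl.
Qed.

(** One factor [w z * (P z + Q z)] is split off and bounded uniformly in [z], using
    [Q <= P + |del|]; what remains sums to [d]. *)
Lemma Ex_wdel_sqr :
  Ex D (ppair i j) (fun a => (w a.1 * del a.1 - w a.2 * del a.2) ^+ 2) <=
  2 * ((2 * Num.sqrt B + Num.sqrt d) * d).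
Proof.
apply: le_trans (Ex_pairB_sqr (fun z => w z * del z)) _.
apply: ler_wpM2l => //; set k := _ + _; rewrite /d mulr_sumr {}/k; apply: ler_sum => z _.
have -> : (P z + Q z) * (w z * del z) ^+ 2 =
          (w z * (P z + Q z)) * (w z * del z ^+ 2) by ring.
apply: ler_wpM2r; first by rewrite mulr_ge0 ?sqr_ge0 ?ltW.
have /= HP := le_sqrt_weighted_sum P z.
have /= Hd := le_sqrt_weighted_sum del z.
rewrite ger0_norm // -/B in HP; rewrite -/d in Hd.
have dn : Q z <= P z + `|del z|.
  by have := ler_norm (- del z); rewrite normrN /del; lra.
have : w z * (P z + Q z) <= w z * (2 * P z + `|del z|).
  by apply: ler_wpM2l; [exact: ltW | lra].
by lra.
Qed.

Lemma Ex_pstat M F : Ex D (pstat w M i j) F =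
  Ex D (prep M (ppair i j)) (fun s => Ex D (prep M (ppair i j))
    (fun t => F (\sum_(a <- s) \sum_(b <- t) kern w a b))).
Proof. by rewrite Ex_bind; apply: eq_Ex => s; rewrite Ex_bind. Qed.

Lemma Ex_pstat_mean M : Ex D (pstat w M i j) id = M%:R ^+ 2 * d.
Proof. by rewrite Ex_pstat Ex_rep_sum2 // Ex_kern. Qed.

Lemma Ex_pstat_sqr M : Ex D (pstat w M i j) (fun u => u ^+ 2) <=
  M%:R ^+ 2 * (16 * B + 4 * d) +
  4 * M%:R ^+ 3 * ((2 * Num.sqrt B + Num.sqrt d) * d) + (M%:R ^+ 2 * d) ^+ 2.
Proof.
rewrite Ex_pstat Ex_rep_sum2_sqr // Ex_kern.
have := Ex_wdel_sqr; set f := Ex D _ _ => fle.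
have -> : Ex D (ppair i j) (fun a => Ex D (ppair i j) (kern w a) ^+ 2) = f.
  by apply: eq_Ex => a; rewrite Ex_kernr.
have -> : Ex D (ppair i j) (fun b => Ex D (ppair i j) (kern w ^~ b) ^+ 2) = f.
  by apply: eq_Ex => b; rewrite Ex_kernl.
have f0 : 0 <= f.
  rewrite -[X in X <= _](Ex_cst D distD (ppair i j)).
  by apply: le_Ex => // a; exact: sqr_ge0.
set e := (_ + _) * d in fle *.
have e0 : 0 <= e by lra.
have k0 : 0 <= M%:R :> R by [].
have k1 : M%:R <= M%:R ^+ 2 :> R.
  by rewrite -natrX ler_nat; case: (M) => // k; rewrite expnS expn1 leq_pmulr.
set k := M%:R in k0 k1 *.
apply: lerD; first apply: lerD.
- by apply: ler_wpM2l; [exact: sqr_ge0 | exact: Ex_kern_sqr].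
(* Both one-sided terms equal [f <= 2 e], whence [4 e]. *)
- apply: (@le_trans _ _ (k * k ^+ 2 * (4 * e))); last by rewrite exprS; lra.
  apply: ler_pM; [| by lra | | by lra].
    by apply: mulr_ge0 => //; lra.
  by apply: ler_wpM2l => //; lra.
- rewrite exprMn; apply: ler_wpM2r; first exact: sqr_ge0.
  by apply: lerXn2r; rewrite ?nnegrE ?sqr_ge0 //; lra.
Qed.

Lemma Ex_pstat_var M : Ex D (pstat w M i j) (fun u => (u - M%:R ^+ 2 * d) ^+ 2) <=
  M%:R ^+ 2 * (16 * B + 4 * d) +
  4 * M%:R ^+ 3 * ((2 * Num.sqrt B + Num.sqrt d) * d).
Proof.
set c := M%:R ^+ 2 * d.
rewrite (@eq_Ex _ _ _ _ _ _ _ (fun u => u ^+ 2 - (2 * c) * u + c ^+ 2)).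
  rewrite ExD ExB Ex_cst // (ExZ D (pstat w M i j) (2 * c) id) Ex_pstat_mean -/c.
  by have := Ex_pstat_sqr M; rewrite -/c; lra.
by move=> u; ring.
Qed.

(** Here [d = 0], so the mean and the cubic variance term vanish, and Markov's inequality applies to
    the square. *)
Lemma ptest_null M tau : D i = D j -> 0 < tau ->
  Ex D (ptest w M tau i j) (fun b => (b != false)%:R) <=
  16 * M%:R ^+ 2 * B / tau ^+ 2.
Proof.
move=> Dij tau0.
have d00 : d = 0.
  by apply: big1 => z _; rewrite /del /P /Q Dij subrr expr0n mulr0.
rewrite Ex_bind /=; apply: le_trans.
  apply: (markov_Ex D distD _ (fun u => u ^+ 2) (tau ^+ 2)
            (fun u => (tau < u) != false)).
  - by rewrite exprn_gt0.
  - by move=> u; exact: sqr_ge0.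
  - move=> u; case: ltP => // tu _.
    by apply: lerXn2r; rewrite ?nnegrE; lra.
apply: ler_wpM2r; first by rewrite invr_ge0 sqr_ge0.
apply: le_trans (Ex_pstat_sqr M) _.
by rewrite d00 !mulr0 expr0n /=; lra.
Qed.

(** The threshold is at most half the mean, so a wrong answer deviates by at least half the mean;
    Chebyshev then costs a factor 4. *)
Lemma ptest_far M tau : 0 < M%:R ^+ 2 * d -> 2 * tau <= M%:R ^+ 2 * d ->
  Ex D (ptest w M tau i j) (fun b => (b != true)%:R) <=
  4 * (M%:R ^+ 2 * (16 * B + 4 * d) +
  4 * M%:R ^+ 3 * ((2 * Num.sqrt B + Num.sqrt d) * d)) / (M%:R ^+ 2 * d) ^+ 2.
Proof.
have := Ex_pstat_var M.
set c := M%:R ^+ 2 * d; set v := _ + _ => var c0 tauc.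
rewrite Ex_bind /=; apply: le_trans.
  apply: (markov_Ex D distD _ (fun u => (u - c) ^+ 2) ((c / 2) ^+ 2)
            (fun u => (tau < u) != true)).
  - by rewrite exprn_gt0 // divr_gt0.
  - by move=> u; exact: sqr_ge0.
  - move=> u; case: ltP => // tu _.
    rewrite -[leRHS]sqrrN; apply: lerXn2r; rewrite ?nnegrE; lra.
have -> : (c / 2) ^+ 2 = c ^+ 2 / 4 by field.
rewrite invf_div mulrA; apply: ler_wpM2r; first by rewrite invr_ge0 sqr_ge0.
by lra.
Qed.

End Test.

(** * Random weights that flatten a distribution *)

Definition flat_weight {R : realType} {n} (S : seq 'I_n) (z : 'I_n) : R :=
  (1 + (count_mem z S)%:R)^-1.

Section Flattening.
Context {R : realType} {n : nat}.

Lemma flat_weight01 (S : seq 'I_n) z : 0 < (flat_weight S z : R) <= 1.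
Proof.
have c0 : 0 <= (count_mem z S)%:R :> R by [].
by rewrite /flat_weight invr_gt0 invf_le1; [apply/andP; split | ]; lra.
Qed.

Lemma sum_inv_flat_weight (S : seq 'I_n) :
  \sum_z (flat_weight S z)^-1 = n%:R + (size S)%:R :> R.
Proof.
under eq_bigr do rewrite invrK.
rewrite big_split /= sumr_const card_ord; congr (_ + _).
rewrite -natr_sum; congr _%:R; elim: S => [|a S IH] /=; first by rewrite big1.
rewrite big_split /= IH (bigD1 a) //= eqxx big1 ?addn0 // => z za.
by rewrite eq_sym (negbTE za).
Qed.

(** Expands the nonnegative sum of [w z * (|c z| - A / (W * w z)) ^ 2]; the case [W = 0], where the
    domain is empty, is separated to allow the division. *)
Lemma cauchy_schwarz_weighted (w c : 'I_n -> R) : (forall z, 0 < w z) ->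
  (\sum_z `|c z|) ^+ 2 <= (\sum_z (w z)^-1) * \sum_z w z * c z ^+ 2.
Proof.
move=> w0; set A := \sum_z `|c z|; set W := \sum_z (w z)^-1.
have W0 : 0 <= W by apply: sumr_ge0 => z _; rewrite invr_ge0 ltW.
set d := \sum_z _.
have [W00|Wn0] := eqVneq W 0.
  have A0 : A = 0.
    apply: big1 => z _; move/eqP: W00; rewrite /W psumr_eq0; last first.
      by move=> x _; rewrite invr_ge0 ltW.
    by move/allP/(_ z (mem_index_enum _)); rewrite /= invr_eq0 gt_eqF.
  by rewrite A0 W00 mul0r expr0n.
have Wp : 0 < W by rewrite lt_neqAle eq_sym Wn0.
have key : 0 <= \sum_z w z * (`|c z| - A / W / w z) ^+ 2.
  by apply: sumr_ge0 => z _; rewrite mulr_ge0 ?sqr_ge0 ?ltW.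
have E z : w z * (`|c z| - A / W / w z) ^+ 2 =
    w z * c z ^+ 2 - (2 * (A / W)) * `|c z| + (A / W) ^+ 2 * (w z)^-1.
  rewrite -[c z ^+ 2]real_normK ?num_real //; field.
  by rewrite Wn0 gt_eqF.
rewrite (eq_bigr _ (fun z _ => E z)) in key.
rewrite big_split sumrB /= -!mulr_sumr -/A -/W -/d in key.
have -> : A ^+ 2 = W * (2 * (A / W) * A - (A / W) ^+ 2 * W) by field.
by apply: ler_wpM2l => //; lra.
Qed.

(* Second-order Taylor bound at [a]: the gap is [(y - a) ^+ 2 * (y - 1)] over
   [a ^+ 2 * y]. *)
Lemma inv_le_quadratic (a y : R) : 0 < a -> 1 <= y ->
  y^-1 <= a^-1 - a ^- 2 * (y - a) + a ^- 2 * (y - a) ^+ 2.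
Proof.
move=> a0 y1; rewrite -subr_ge0.
have -> : a^-1 - a ^- 2 * (y - a) + a ^- 2 * (y - a) ^+ 2 - y^-1 =
          (y - a) ^+ 2 * (y - 1) / (a ^+ 2 * y).
  by field; rewrite !gt_eqF //; lra.
apply: divr_ge0; apply: mulr_ge0; rewrite ?sqr_ge0 //; lra.
Qed.

Context {m : nat}.
Variable D : 'I_m -> {ffun 'I_n -> R}.
Hypothesis distD : forall i, is_dist (D i).

(** [inv_le_quadratic] is used at the mean [a = 1 + K p] of one plus the count: the linear term
    averages to zero, and the binomial variance [K p (1 - p)] is at most [a]. *)
Lemma Ex_flat_weight i z K :
  Ex D (prep K (PSample i PRet)) (fun S => flat_weight S z) <=
  2 / (1 + K%:R * D i z).
Proof.
set p := D i z; set a := 1 + K%:R * p.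
have [D0 D1] := distD i.
have p0 : 0 <= p by exact: D0.
have Kp0 : 0 <= K%:R * p by rewrite mulr_ge0.
have a0 : 0 < a by rewrite /a; lra.
have cE (S : seq 'I_n) : (count_mem z S)%:R = \sum_(x <- S) (x == z)%:R :> R.
  by elim: S => [|x S IH]; rewrite ?big_nil // big_cons /= natrD IH.
have mean1 : Ex D (PSample i PRet) (fun x => (x == z)%:R) = p.
  rewrite /= (bigD1 z) //= eqxx mulr1 big1 ?addr0 // => x xz.
  by rewrite (negbTE xz) mulr0.
have mean2 : Ex D (PSample i PRet) (fun x => (x == z)%:R ^+ 2) = p.
  by rewrite -mean1; apply: eq_Ex => x; case: (x == z); rewrite ?expr1n ?expr0n.
apply: (@le_trans _ _ (Ex D (prep K (PSample i PRet)) (fun S =>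
   (a^-1 + a ^- 2 * (a - 1) + a ^- 2 * (a - 1) ^+ 2)
   - (a ^- 2 * (1 + 2 * (a - 1))) * (\sum_(x <- S) (x == z)%:R)
   + a ^- 2 * (\sum_(x <- S) (x == z)%:R) ^+ 2))).
  apply: le_Ex => // S; rewrite /flat_weight cE; set c := \sum_(x <- S) _.
  have c0 : 0 <= c by apply: sumr_ge0.
  have /= := @inv_le_quadratic a (1 + c) a0; rewrite lerDl => /(_ c0).
  move/le_trans; apply; rewrite le_eqVlt; apply/orP; left; apply/eqP; ring.
rewrite ExD ExB !ExZ Ex_cst // Ex_rep_sum // Ex_rep_sum_sqr // mean1 mean2.
have -> : 2 / a = a^-1 + a ^- 2 * a by field; rewrite gt_eqF.
have aE : K%:R * p = a - 1 by rewrite /a; ring.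
(* The slack in the bound: [a - K p (1 - p) = 1 + K p ^ 2]. *)
have : 0 <= a ^- 2 * (K%:R * p * p + 1).
  rewrite mulr_ge0 // ?invr_ge0 ?sqr_ge0 //.
  by have : 0 <= K%:R * p * p by [rewrite mulr_ge0]; lra.
have -> : (K%:R ^+ 2 - K%:R) * p ^+ 2 = (a - 1) ^+ 2 - K%:R * p * p.
  by rewrite -aE; ring.
rewrite aE; lra.
Qed.

(** Termwise [2 p ^ 2 / (1 + K p) <= 2 p / K], and the [p] sum to 1. *)
Lemma Ex_flat_norm i K : (0 < K)%N ->
  Ex D (prep K (PSample i PRet))
     (fun S => \sum_z flat_weight S z * D i z ^+ 2) <= 2 / K%:R.
Proof.
move=> K0; have K0' : 0 < K%:R :> R by rewrite ltr0n.
have [D0 D1] := distD i.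
have -> : 2 / K%:R = \sum_z 2 / K%:R * D i z by rewrite -mulr_sumr D1 mulr1.
rewrite Ex_sum; apply: ler_sum => z _.
rewrite (@eq_Ex _ _ _ _ _ _ _ (fun S => D i z ^+ 2 * flat_weight S z)); last first.
  by move=> S; rewrite mulrC.
rewrite ExZ; have p0 : 0 <= D i z by [].
apply: (@le_trans _ _ (D i z ^+ 2 * (2 / (1 + K%:R * D i z)))).
  by apply: ler_wpM2l; [exact: sqr_ge0 | exact: Ex_flat_weight].
have Kp0 : 0 <= K%:R * D i z by rewrite mulr_ge0 // ltW.
rewrite -subr_ge0.
have -> : 2 / K%:R * D i z - D i z ^+ 2 * (2 / (1 + K%:R * D i z)) =
          2 * D i z / (K%:R * (1 + K%:R * D i z)).
  by field; rewrite !gt_eqF //; lra.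
by rewrite divr_ge0 ?mulr_ge0 //; lra.
Qed.

End Flattening.

(** * Majority votes, search over the indices, and the full procedure *)

Definition pvote {m n} (L : nat) (v : proc m n bool) : proc m n bool :=
  pbind (prep L v) (fun s => PRet (size s <= 2 * count id s)%N).

Fixpoint pfind {m n} (v : 'I_m -> proc m n bool) (js : seq 'I_m) :
    proc m n (option 'I_m) :=
  if js is j :: js' then
    pbind (v j) (fun b => if b then PRet (Some j) else pfind v js')
  else PRet None.

(** Relative to the list still to be scanned, to allow induction along the search. *)
Definition bad_out {m} (chi : {set 'I_m}) (js : seq 'I_m) (r : option 'I_m) : bool :=
  if r is Some j then j \in chi else has (fun j => j \notin chi) js.

(** One flattening sample serves all tests, so [K] is not multiplied by [m]. The scan includes [i0],
    compared with itself. *)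
Definition pmain {R : realType} {m n} (K M L : nat) (tau : R) (i0 : 'I_m) :
    proc m n (option 'I_m) :=
  pbind (prep K (PSample i0 PRet)) (fun S =>
    pfind (fun j => pvote L (ptest (flat_weight S) M tau i0 j)) (enum 'I_m)).

Lemma pmain_cost {R : realType} {m n} (K M L : nat) (tau : R) (i0 : 'I_m) :
  cost_le (K + m * (L * (4 * M))) (@pmain R m n K M L tau i0).
Proof.
have pair_cost j : cost_le 2 (@ppair m n i0 j) by [].
apply: cost_le_bind => [|S].
  by have := @cost_le_rep m n _ 1 K (PSample i0 PRet); rewrite muln1; apply.
rewrite -[X in (X * _)%N](size_enum_ord m); elim: (enum _) => [//|j js IH].
rewrite (mulSn (size js)); apply: cost_le_bind => [|b]; last first.
  by case: b => //; apply: cost_leW IH.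
apply: cost_le_map; apply: cost_le_rep; apply: cost_le_map.
have -> : (4 * M = M * 2 + M * 2)%N by lia.
apply: cost_le_bind => [|s]; first exact: cost_le_rep.
by apply: cost_le_map; exact: cost_le_rep.
Qed.

(** * Error probability of one test and of the search *)

Lemma quartic_dominates {R : realType} (y u : R) : 0 <= u -> 1000 <= y ->
  1000 * u <= y ^+ 2 ->
  4 * (16 * u ^+ 2 + 4 * y ^+ 2 + 8 * (u * y ^+ 2) + 4 * y ^+ 3) <= 16^-1 * y ^+ 4.
Proof.
move=> u0 y1 uy.
have y20 : 0 <= y ^+ 2 by exact: sqr_ge0.
have h1 : 1000 * u ^+ 2 <= u * y ^+ 2.
  have -> : 1000 * u ^+ 2 = u * (1000 * u) by ring.
  exact: ler_wpM2l.
have h2 : 1000 * y ^+ 2 <= y ^+ 3 by rewrite [y ^+ 3]exprS; apply: ler_wpM2r.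
have h3 : 1000 * (u * y ^+ 2) <= y ^+ 4.
  have -> : y ^+ 4 = y ^+ 2 * y ^+ 2 by ring.
  by rewrite mulrA; apply: ler_wpM2r.
have h4 : 1000 * y ^+ 3 <= y ^+ 4.
  by rewrite [y ^+ 4]exprS; apply: ler_wpM2r => //; apply: exprn_ge0; lra.
lra.
Qed.

Lemma dTVxx {R : realType} {n} (p : {ffun 'I_n -> R}) : dTV p p = 0.
Proof. by rewrite /dTV big1 ?mulr0 // => x _; rewrite subrr normr0. Qed.

(** Everything is measured by [X = M * sqrt |S| * eps ^ 2 / n >= 2000]. The threshold is half the
    least mean that a distance of [eps] allows. *)
Lemma ptest_correct {R : realType} {m n} (D : 'I_m -> {ffun 'I_n -> R})
    (S : seq 'I_n) (M : nat) (eps : R) (i j : 'I_m) :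
  (forall i, is_dist (D i)) -> (0 < size S <= n)%N -> 0 < eps < 1 ->
  2000 * n%:R <= M%:R * Num.sqrt (size S)%:R * eps ^+ 2 ->
  \sum_z flat_weight S z * D i z ^+ 2 <= 12 / (size S)%:R ->
  D i = D j \/ eps <= dTV (D i) (D j) ->
  Ex D (ptest (flat_weight S) M (M%:R ^+ 2 * eps ^+ 2 / n%:R) i j)
    (fun b => (b != (D i != D j))%:R) <= 16^-1.
Proof.
move=> distD /andP[K0 Kn] /andP[e0 e1]; set N := n%:R; set e := eps ^+ 2.
have N0 : 0 < N :> R by rewrite ltr0n (leq_trans K0).
have ep : 0 < e by rewrite exprn_gt0.
have e1' : e <= 1 by rewrite exprn_ile1 // ltW.
have Kp : 0 < (size S)%:R :> R by rewrite ltr0n.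
have KN : (size S)%:R <= N by rewrite ler_nat.
set k := Num.sqrt (size S)%:R.
have k0 : 0 < k by rewrite sqrtr_gt0.
have k2 : (size S)%:R = k ^+ 2 by rewrite sqr_sqrtr // ltW.
have W : \sum_z (flat_weight S z)^-1 <= 2 * N by rewrite sum_inv_flat_weight; lra.
rewrite k2 in KN *; move=> HM; set B := \sum_z _ => HB Dij.
have Mp : 0 < M%:R :> R.
  rewrite ltr0n lt0n; apply/negP => /eqP M0; move: HM.
  by rewrite M0 !mul0r; lra.
set u := M%:R in HM Mp *.
have [X XE] : exists X, X = u * k * e / N by eexists.
have X2000 : 2000 <= X by rewrite XE ler_pdivlMr.
have X0 : 0 <= X by rewrite (le_trans _ X2000) ?ler0n.
have X2 : 2000 * X <= X ^+ 2 by rewrite expr2; apply: ler_wpM2r.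
have uX : k * X <= u.
  rewrite XE mulrA ler_pdivrMr //.
  apply: (@le_trans _ _ (u * k ^+ 2)); last by apply: ler_wpM2l => //; exact: ltW.
  have -> : k * (u * k * e) = u * k ^+ 2 * e by ring.
  by rewrite ger_pMr // mulr_gt0 // exprn_gt0.
have w01 := @flat_weight01 R n S.
(* In the equal case the threshold is [u * X / k], and the error is at most [192 / X ^ 2]. *)
have [DE|Dn] := eqVneq (D i) (D j).
  apply: le_trans (ptest_null D distD i j _ w01 M _ DE _) _.
    by rewrite divr_gt0 // mulr_gt0 // exprn_gt0.
  rewrite -/B -/u ler_pdivrMr; last first.
    by rewrite exprn_gt0 // divr_gt0 // mulr_gt0 // exprn_gt0.
  have -> : u ^+ 2 * e / N = u * X / k by rewrite XE; field; rewrite !gt_eqF.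
  apply: (@le_trans _ _ (16 * u ^+ 2 * (12 / k ^+ 2))).
    by apply: ler_wpM2l => //; rewrite mulr_ge0 // sqr_ge0.
  have -> : 16^-1 * (u * X / k) ^+ 2 = 16^-1 * X ^+ 2 * (u ^+ 2 / k ^+ 2).
    by field; rewrite gt_eqF.
  have -> : 16 * u ^+ 2 * (12 / k ^+ 2) = 16 * 12 * (u ^+ 2 / k ^+ 2).
    by field; rewrite gt_eqF.
  apply: ler_wpM2r; last by lra.
  by rewrite divr_ge0 // sqr_ge0.
have far : eps <= dTV (D i) (D j).
  by case: Dij => // E; rewrite E eqxx in Dn.
pose d := \sum_z flat_weight S z * (D i z - D j z) ^+ 2.
(* The absolute differences sum to at least [2 * eps], while the inverse weights sum to at most
   [2 * N]. *)
have dlow : 2 * e / N <= d.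
  rewrite ler_pdivrMr //.
  have /= CS := @cauchy_schwarz_weighted R n (flat_weight S)
    (fun z => D i z - D j z) (fun z => proj1 (andP (w01 z))).
  have l1 : 2 * eps <= \sum_z `|D i z - D j z| by rewrite mulrC -ler_pdivlMr // mulrC.
  have l2 : (2 * eps) ^+ 2 <= (\sum_z `|D i z - D j z|) ^+ 2.
    have eps0 : 0 <= 2 * eps by rewrite mulr_ge0 // ltW.
    by apply: lerXn2r; rewrite ?nnegrE // (le_trans eps0).
  have d0 : 0 <= d.
    apply: sumr_ge0 => z _; rewrite mulr_ge0 ?sqr_ge0 //.
    by apply: ltW; case/andP: (w01 z).
  have : (\sum_z (flat_weight S z)^-1) * d <= 2 * N * d by apply: ler_wpM2r.
  have -> : 2 * e = (2 * eps) ^+ 2 / 2 by rewrite /e; field.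
  by rewrite -/d in CS; lra.
have dp : 0 < d by apply: lt_le_trans dlow; rewrite divr_gt0 // mulr_gt0.
have ud : 2 * X / k <= u * d.
  have -> : 2 * X / k = u * (2 * e / N) by rewrite XE; field; rewrite !gt_eqF.
  by apply: ler_wpM2l => //; exact: ltW.
apply: le_trans (ptest_far D distD i j _ w01 M _ _ _) _; rewrite -/B -/d -/u.
- by rewrite mulr_gt0 // exprn_gt0.
- have -> : 2 * (u ^+ 2 * e / N) = u ^+ 2 * (2 * e / N) by ring.
  by apply: ler_wpM2l => //; exact: sqr_ge0.
have B0 : 0 <= B.
  apply: sumr_ge0 => z _; rewrite mulr_ge0 ?sqr_ge0 //.
  by apply: ltW; case/andP: (w01 z).
rewrite ler_pdivrMr; last by rewrite exprn_gt0 // mulr_gt0 // exprn_gt0.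
set b := Num.sqrt B; set c := Num.sqrt d.
have b0 : 0 <= b by exact: sqrtr_ge0.
have c0 : 0 < c by rewrite sqrtr_gt0.
have BE : B = b ^+ 2 by rewrite sqr_sqrtr.
have dE : d = c ^+ 2 by rewrite sqr_sqrtr // ltW.
have bk : b <= 4 / k.
  have k40 : 0 <= 4 / k by rewrite divr_ge0 // ltW.
  rewrite -(ger0_norm k40) -sqrtr_sqr; apply: ler_wsqrtr.
  apply: le_trans HB _; rewrite exprMn exprVn; apply: ler_wpM2r.
    by rewrite invr_ge0 sqr_ge0.
  by lra.
have y2 : X ^+ 2 <= (u * c) ^+ 2.
  rewrite [(u * c) ^+ 2]exprMn -dE [u ^+ 2]expr2 -mulrA.
  apply: (@le_trans _ _ (k * X * (2 * X / k))); last first.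
    by apply: ler_pM => //; rewrite ?divr_ge0 ?mulr_ge0 // ltW.
  have -> : k * X * (2 * X / k) = 2 * X ^+ 2 by field; rewrite gt_eqF.
  by rewrite ler_peMl ?sqr_ge0 // ler1n.
have y1 : 1000 <= u * c.
  have Xuc : X <= u * c.
    have uc0 : 0 <= u * c by rewrite mulr_ge0 // ltW.
    by move: y2; rewrite ler_pXn2r.
  by apply: le_trans Xuc; apply: le_trans X2000; rewrite ler_nat.
(* After cancelling [u]: [1000 * b <= 4000 / k <= 2 * X / k <= u * d]. *)
have ub : 1000 * (u * b) <= (u * c) ^+ 2.
  rewrite [(u * c) ^+ 2]exprMn -dE [u ^+ 2]expr2 -mulrA mulrCA.
  apply: ler_wpM2l; first exact: ltW.
  apply: le_trans ud; rewrite ler_pdivlMr //.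
  have : b * k <= 4 by rewrite -ler_pdivlMr.
  by lra.
have u0b : 0 <= u * b by rewrite mulr_ge0 // ltW.
(* In terms of [u * sqrt B] and [u * sqrt d] the squared mean is the fourth power of the latter and
   beats each variance term. *)
have := quartic_dominates _ _ u0b y1 ub.
rewrite BE dE => /le_trans H.
have -> : 4 * (u ^+ 2 * (16 * b ^+ 2 + 4 * c ^+ 2) +
  4 * u ^+ 3 * ((2 * b + c) * c ^+ 2)) = 4 * (16 * (u * b) ^+ 2 + 4 * (u * c) ^+ 2 +
  8 * (u * b * (u * c) ^+ 2) + 4 * (u * c) ^+ 3) by ring.
by apply: H; rewrite le_eqVlt; apply/orP; left; apply/eqP; ring.
Qed.

(** Union bound by induction: a correct first vote either stops at a valid index or leaves the bad
    event to the tail; a wrong one is charged [err]. *)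
Lemma pfind_bad {R : realType} {m n} (D : 'I_m -> {ffun 'I_n -> R})
    (chi : {set 'I_m}) (v : 'I_m -> proc m n bool) (err : R) (js : seq 'I_m) :
  (forall i, is_dist (D i)) ->
  (forall j, Ex D (v j) (fun b => (b != (j \notin chi))%:R) <= err) ->
  Ex D (pfind v js) (fun r => (bad_out chi js r)%:R) <= (size js)%:R * err.
Proof.
move=> distD verr; elim: js => [|j js IH]; first by rewrite /= mul0r.
have ge0 T (p : proc m n T) (F : T -> bool) : 0 <= Ex D p (fun t => (F t)%:R).
  by rewrite -[X in X <= _](Ex_cst D distD p); apply: le_Ex.
have sz0 : 0 <= (size js)%:R * err by apply: le_trans IH; exact: ge0.
rewrite Ex_bind -[size (j :: js)]add1n natrD mulrDl mul1r.
apply: (@le_trans _ _ (Ex D (v j) (fun b => (b != (j \notin chi))%:R +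
    (size js)%:R * err))); last first.
  by rewrite ExD Ex_cst // lerD2r.
apply: le_Ex => // b; have [jchi|jchi] := boolP (j \in chi); case: b => //=.
- by rewrite jchi lerDl.
- rewrite add0r; apply: le_trans IH; apply: le_Ex => // r.
  by case: r => [r|] //=; rewrite jchi.
- by rewrite (negbTE jchi) add0r.
- apply: (@le_trans _ _ 1); last by rewrite lerDl.
  rewrite -[X in _ <= X](Ex_cst D distD (pfind v js)); apply: le_Ex => // r.
  by rewrite lern1 leq_b1.
Qed.

Lemma pmain_bad {R : realType} {m n} (D : 'I_m -> {ffun 'I_n -> R})
    (chi : {set 'I_m}) (K M L : nat) (eps : R) (i0 : 'I_m) :
  (forall i, is_dist (D i)) -> (0 < K <= n)%N -> 0 < eps < 1 ->
  2000 * n%:R <= M%:R * Num.sqrt K%:R * eps ^+ 2 -> (6 * m <= 2 ^ L)%N ->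
  (forall j, j \in chi -> D i0 = D j) ->
  (forall j, j \notin chi -> eps <= dTV (D i0) (D j)) ->
  Ex D (pmain K M L (M%:R ^+ 2 * eps ^+ 2 / n%:R) i0)
    (fun r => (bad_out chi (enum 'I_m) r)%:R) <= 3^-1.
Proof.
move=> distD Kn eps01 HM HL Dchi Dnchi.
have K0 : 0 < K%:R :> R by rewrite ltr0n; case/andP: Kn.
have neqE j : (D i0 != D j) = (j \notin chi).
  apply/idP/idP => [|jc]; first by apply: contra => /Dchi/eqP.
  apply/eqP => E; have := Dnchi j jc; rewrite E dTVxx.
  by case/andP: eps01 => ? ?; rewrite leNgt => /negP.
(* Six times the mean bound [2 / K], so Markov gives 1/6; the votes contribute another 1/6. *)
pose big (S : seq 'I_n) : bool := 12 / K%:R < \sum_z flat_weight S z * D i0 z ^+ 2.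
rewrite Ex_bind.
apply: (@le_trans _ _ (Ex D (prep K (PSample i0 PRet))
          (fun S => (big S)%:R + m%:R * 2^-1 ^+ L))).
  apply: le_Ex_rep => // S SK; set v := fun j => _.
  have [bS|nbS] := boolP (big S).
    apply: (@le_trans _ _ 1); last by rewrite lerDl mulr_ge0 // exprn_ge0.
    rewrite -[X in _ <= X](Ex_cst D distD (pfind v (enum 'I_m))).
    by apply: le_Ex => // r; rewrite lern1 leq_b1.
  rewrite add0r -[X in X%:R * _](size_enum_ord m).
  apply: pfind_bad => // j; rewrite Ex_bind /=; apply: majority_Ex => //.
  rewrite -neqE; apply: ptest_correct => //; rewrite ?SK //.
    by rewrite leNgt.
  have [jc|jc] := boolP (j \in chi); [left; exact: Dchi | right; exact: Dnchi].
rewrite ExD Ex_cst //.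
have c0 : 0 < 12 / K%:R :> R by rewrite divr_gt0.
have h1 : Ex D (prep K (PSample i0 PRet)) (fun S => (big S)%:R) <= 6^-1.
  apply: le_trans (markov_Ex D distD _
    (fun S => \sum_z flat_weight S z * D i0 z ^+ 2) _ big c0 _ _) _.
  - move=> S; apply: sumr_ge0 => z _; rewrite mulr_ge0 ?sqr_ge0 //.
    by apply: ltW; case/andP: (@flat_weight01 R n S z).
  - by move=> S; exact: ltW.
  rewrite ler_pdivrMr //; apply: le_trans (Ex_flat_norm D distD i0 K _) _.
    by case/andP: Kn.
  by lra.
have h2 : m%:R * 2^-1 ^+ L <= 6^-1 :> R.
  rewrite exprVn ler_pdivrMr ?exprn_gt0 //.
  have : (6 * m)%:R <= (2 ^ L)%:R :> R by rewrite ler_nat.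
  by rewrite natrM natrX; lra.
by lra.
Qed.

(** * Choice of the parameters and the sample budget *)

Lemma ln2_ge {R : realType} : 2^-1 <= ln 2 :> R.
Proof.
have := @le_ln1Dx R (- 2^-1); have -> : 1 + - 2^-1 = 2^-1 :> R by field.
rewrite lnV ?posrE // lerN2; apply.
by rewrite ltrN2 invf_lt1 // ltr1n.
Qed.

Lemma ln_nat_ge {R : realType} (m : nat) : (2 <= m)%N -> 2^-1 <= ln m%:R :> R.
Proof.
move=> m2; apply: le_trans ln2_ge _; rewrite ler_ln ?posrE ?ltr0n ?ler_nat //.
exact: leq_trans m2.
Qed.

Definition vote_size (m : nat) : nat := trunc_log 2 m + 4.

Lemma vote_size_ge (m : nat) : (6 * m <= 2 ^ vote_size m)%N.
Proof.
have := @trunc_log_ltn 2 m isT; rewrite /vote_size expnD expnS.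
by set t := (2 ^ trunc_log 2 m)%N; lia.
Qed.

(** With [t = trunc_log 2 m >= 1], [t + 4 <= 5 t], and [t / 2 <= t * ln 2 <= ln m]. *)
Lemma vote_size_le {R : realType} (m : nat) :
  (2 <= m)%N -> (vote_size m)%:R <= 10 * ln m%:R :> R.
Proof.
move=> m2; have t1 : (1 <= trunc_log 2 m)%N by apply: trunc_log_max.
have m0 : (0 < m)%N by exact: leq_trans m2.
have tm : (trunc_log 2 m)%:R * ln 2 <= ln m%:R :> R.
  rewrite mulr_natl -lnXn // ler_ln ?posrE ?exprn_gt0 ?ltr0n //.
  by rewrite -natrX ler_nat trunc_logP.
have ht : (trunc_log 2 m)%:R * 2^-1 <= (trunc_log 2 m)%:R * ln 2 :> R.
  by apply: ler_wpM2l => //; exact: ln2_ge.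
have t1' : 1 <= (trunc_log 2 m)%:R :> R by rewrite ler1n.
by rewrite /vote_size natrD; lra.
Qed.

Section SampleSizes.
Context {R : realType}.
Variables (n m : nat) (eps : R).

Definition flat_size : nat :=
  Num.truncn (Num.min n%:R ((n%:R * m%:R / eps ^+ 2) `^ (2 / 3))).

(* The constant 2000 brings the error of a single test below 1/16. *)
Definition half_size : nat :=
  (Num.truncn (2000 * (n%:R / (Num.sqrt flat_size%:R * eps ^+ 2)))).+1.

Hypotheses (n27 : (27 <= n)%N) (m2 : (2 <= m)%N) (eps01 : 0 < eps < 1).

Let Z : R := n%:R * m%:R / eps ^+ 2.
Let X := Z `^ (2 / 3).
Let e2 : 0 < eps ^+ 2 <= 1.
Proof.
by case/andP: eps01 => e0 e1; rewrite exprn_gt0 // exprn_ile1 // ltW.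
Qed.
Let n1 : 1 <= n%:R :> R. Proof. by rewrite ler1n (leq_trans _ n27). Qed.
Let m1 : 1 <= m%:R :> R. Proof. by rewrite ler1n (leq_trans _ m2). Qed.
Let Z1 : 1 <= Z.
Proof.
case/andP: e2 => ? ?; rewrite /Z ler_pdivlMr // mul1r.
by apply: (@le_trans _ _ 1) => //; rewrite mulr_ege1.
Qed.
Let Z0 : 0 < Z. Proof. exact: lt_le_trans Z1. Qed.
Let X1 : 1 <= X.
Proof. by rewrite -(powRr0 Z) /X; apply: ler_powR => //; rewrite divr_ge0. Qed.
(** The balance behind the exponent 2/3: with [K] near [X], the testing cost [Z / sqrt K] is again
    of order [X]. *)
Let XZ : X * Num.sqrt X = Z.
Proof.
rewrite -powR12_sqrt; last by rewrite /X powR_ge0.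
rewrite /X -powRrM -powRD; last by rewrite gt_eqF // implybT.
have -> : 2 / 3 + 2 / 3 * 2^-1 = 1 :> R by field.
by rewrite powRr1 // ltW.
Qed.

(** The truncated minimum is at least 1, so truncation loses at most a factor 2. *)
Lemma flat_size_bounds : [/\ (0 < flat_size <= n)%N,
  flat_size%:R <= (n%:R * m%:R / eps ^+ 2) `^ (2 / 3) &
  Num.min n%:R ((n%:R * m%:R / eps ^+ 2) `^ (2 / 3)) <= 2 * flat_size%:R].
Proof.
rewrite /flat_size -/Z -/X; set Y := Num.min _ _.
have Y1 : 1 <= Y by rewrite /Y le_min n1.
have /truncn_itv /andP[lo hi] : 0 <= Y by exact: le_trans Y1.
have [Yn YX] : Y <= n%:R /\ Y <= X by rewrite /Y !ge_min !lexx orbT.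
have K0 : (0 < Num.truncn Y)%N.
  by rewrite lt0n; apply/eqP => E; move: hi; rewrite E; rewrite ltNge Y1.
split; first by rewrite K0 -(ler_nat R) (le_trans lo).
  exact: le_trans lo YX.
have : 1 <= (Num.truncn Y)%:R :> R by rewrite ler1n.
by move: hi; rewrite -natr1; lra.
Qed.

Let K := flat_size.
Let M := half_size.
Let rt := Num.sqrt K%:R : R.
Let rt0 : 0 < rt.
Proof. by rewrite sqrtr_gt0 ltr0n; case: flat_size_bounds => /andP[]. Qed.

Let rte0 : 0 < rt * eps ^+ 2.
Proof. by case/andP: e2 => e0 _; rewrite mulr_gt0. Qed.

Lemma half_size_ge : 2000 * n%:R <= M%:R * rt * eps ^+ 2.
Proof.
have q0 : 0 <= 2000 * (n%:R / (rt * eps ^+ 2)).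
  by rewrite mulr_ge0 ?ler0n // divr_ge0 // ltW.
have /andP[_ /ltW hi] := truncn_itv q0.
by rewrite -[_ * rt * _]mulrA -ler_pdivrMr // -[2000 * _ / _]mulrA.
Qed.

(** If [K] is near [n], [m * q] is at most twice the second term of the maximum; if near [X], twice
    the first, by [XZ]. *)
Lemma half_size_le : m%:R * M%:R <= 4002 *
  Num.max X (m%:R * Num.sqrt n%:R / eps ^+ 2).
Proof.
case/andP: e2 => e0 e1; have eps0 : 0 < eps by case/andP: eps01.
set Y := _ / eps ^+ 2.
have [/andP[K0 Kn] KX minK] := flat_size_bounds; rewrite -/Z -/X -/K in KX minK.
have K0' : 0 < K%:R :> R by rewrite ltr0n.
set q := n%:R / (rt * eps ^+ 2).
have rt2 : rt ^+ 2 = K%:R by rewrite sqr_sqrtr // ltW.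
have rtn : rt * eps ^+ 2 <= n%:R.
  apply: (@le_trans _ _ (rt * 1)); first by apply: ler_wpM2l => //; exact: ltW.
  apply: (@le_trans _ _ K%:R); last by rewrite ler_nat.
  rewrite mulr1 -rt2 expr2 ler_peMr ?(ltW rt0) //.
  by rewrite -sqrtr1; apply: ler_wsqrtr; rewrite ler1n.
have q1 : 1 <= q by rewrite /q ler_pdivlMr // mul1r.
have q20 : 0 <= 2000 * q by rewrite mulr_ge0 ?ler0n // (le_trans _ q1).
(* The successor in [half_size] is absorbed by [1 <= q]. *)
have Mq : M%:R <= 2001 * q.
  have /andP[lo _] := truncn_itv q20.
  by rewrite /M /half_size -/q -natr1; lra.
suff mq : m%:R * q <= 2 * Num.max X Y.
  apply: (@le_trans _ _ (m%:R * (2001 * q))); first exact: ler_wpM2l.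
  by lra.
have mqZ : m%:R * q = Z / rt by rewrite /q /Z; field; rewrite !gt_eqF.
have [nX|Xn] := leP n%:R X.
  rewrite min_l // in minK.
  apply: (@le_trans _ _ (2 * Y)); last by rewrite ler_pM2l // le_max lexx orbT.
  have sn0 : 0 < Num.sqrt n%:R :> R by rewrite sqrtr_gt0; exact: lt_le_trans n1.
  have sn2 : Num.sqrt n%:R ^+ 2 = n%:R :> R by rewrite sqr_sqrtr.
  have snr : Num.sqrt n%:R <= 2 * rt.
    rewrite -(@ler_pXn2r _ 2) // ?nnegrE ?mulr_ge0 ?(ltW rt0) ?(ltW sn0) //.
    by rewrite exprMn rt2 sn2; lra.
  have -> : 2 * Y = m%:R / eps ^+ 2 * (2 * Num.sqrt n%:R) by rewrite /Y; ring.
  have -> : m%:R * q = m%:R / eps ^+ 2 * (n%:R / rt).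
    by rewrite /q; field; rewrite !gt_eqF.
  apply: ler_wpM2l; first by rewrite divr_ge0 // ltW.
  rewrite ler_pdivrMr //.
  have -> : 2 * Num.sqrt n%:R * rt = Num.sqrt n%:R * (2 * rt) by ring.
  by rewrite -{1}sn2 expr2; apply: ler_wpM2l => //; exact: ltW.
rewrite min_r // in minK; last exact: ltW.
apply: (@le_trans _ _ (2 * X)); last by rewrite ler_pM2l // le_max lexx.
have X0 : 0 < X by exact: lt_le_trans X1.
rewrite mqZ ler_pdivrMr // -XZ; have -> : 2 * X * rt = X * (2 * rt) by ring.
apply: ler_wpM2l; first exact: ltW.
have sX2 : Num.sqrt X ^+ 2 = X by rewrite sqr_sqrtr // ltW.
rewrite -(@ler_pXn2r _ 2) // ?nnegrE ?mulr_ge0 ?(ltW rt0) ?sqrtr_ge0 //.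
by rewrite exprMn rt2 sX2; lra.
Qed.

(** [K] costs at most [2 * Y * ln m] since [ln m >= 1/2], and the tests at most
    [4 * 4002 * 10 = 160080] times [Y * ln m]. *)
Lemma sample_budget :
  (K + m * (vote_size m * (4 * M)))%:R <= 1000 * 200 *
  Num.max X (m%:R * Num.sqrt n%:R / eps ^+ 2) * ln m%:R.
Proof.
set Y := Num.max _ _.
have lm := @ln_nat_ge R m m2; have lv := @vote_size_le R m m2; have hm := half_size_le.
rewrite -/Y in hm; have [_ KX _] := flat_size_bounds.
have KY : K%:R <= Y by apply: le_trans KX _; rewrite /Y le_max lexx.
have Y0 : 0 <= Y by apply: le_trans KY.
have -> : (K + m * (vote_size m * (4 * M)))%:R =
    K%:R + 4 * (m%:R * M%:R * (vote_size m)%:R) :> R by rewrite natrD !natrM; ring.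
have l0 : 0 <= ln m%:R :> R by lra.
have h1 : m%:R * M%:R * (vote_size m)%:R <= 4002 * Y * (10 * ln m%:R).
  by apply: ler_pM => //; rewrite mulr_ge0.
have h2 : Y <= 2 * (Y * ln m%:R).
  have : Y * 2^-1 <= Y * ln m%:R by apply: ler_wpM2l.
  by lra.
have h3 : 0 <= Y * ln m%:R by rewrite mulr_ge0.
by lra.
Qed.

End SampleSizes.

(** * The algorithm and its guarantee *)

Definition find_one_unknown {R : realType} (n m : nat) (eps : R) : alg m n :=
  match m with
  | 0 => Ret None
  | m'.+1 => alg_of (pmain (flat_size n m'.+1 eps) (half_size n m'.+1 eps)
      (vote_size m'.+1) ((half_size n m'.+1 eps)%:R ^+ 2 * eps ^+ 2 / n%:R) ord0)
  end.

Theorem theoremC2 (R : realType) :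
  exists C : R, 0 < C /\
  exists A : forall (n m : nat) (eps : R), alg m n,
  forall (n m : nat) (eps : R), (27 <= n)%N -> (2 <= m)%N -> 0 < eps < 1 ->
  forall (P Q : {ffun 'I_n -> R}), is_dist P -> is_dist Q -> eps <= dTV P Q ->
  forall (chi : {set 'I_m}) (D : 'I_m -> {ffun 'I_n -> R}),
    (forall i : 'I_m, val i = 0%N -> i \in chi) ->
    (forall i : 'I_m, i \in chi -> D i = P) ->
    (forall i : 'I_m, i \notin chi -> D i = Q) ->
    let good (o : option 'I_m) : bool :=
      if chi == [set: 'I_m]%SET then o == None
      else match o with
           | None => false
           | Some j => (val j != 0%N) &&
                       [forall i : 'I_m, (val i == 0%N) ==> (D j != D i)]
           end in
    2 / 3 <= success_prob D good (A n m eps) /\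
    exists s : nat,
      uses_at_most s (A n m eps) /\
      s%:R <= C * Num.max ((n%:R * m%:R / eps ^+ 2) `^ (2 / 3))
                          (m%:R * Num.sqrt n%:R / eps ^+ 2) * ln m%:R.
Proof.
exists (1000 * 200); split; first by apply: mulr_gt0; rewrite ltr0n.
exists (@find_one_unknown R) => n [//|m] eps n27 m2 eps01 P Q dP dQ far chi D.
move=> chi0 DP DQ good.
have distD i : is_dist (D i).
  by have [/DP ->|/DQ ->] := boolP (i \in chi).
have D0 : D ord0 = P by apply: DP; exact: chi0.
split; last first.
  by eexists; split; [apply: uses_alg_of; apply: pmain_cost | apply: sample_budget].
rewrite /find_one_unknown success_alg_of; set p := pmain _ _ _ _ _.
have bad : Ex D p (fun r => (bad_out chi (enum 'I_m.+1) r)%:R) <= 3^-1.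
  apply: pmain_bad => //.
  - by case: (flat_size_bounds n m.+1 eps n27 m2 eps01).
  - exact: half_size_ge.
  - exact: vote_size_ge.
  - by move=> j /DP ->; exact: D0.
  - by move=> j /DQ ->; rewrite D0.
(* Every output is good or bad, so success has probability at least 1 - 1/3. *)
have le1 : 1 <= Ex D p (fun r => (good r)%:R) +
                Ex D p (fun r => (bad_out chi (enum 'I_m.+1) r)%:R).
  rewrite -ExD -[X in X <= _](Ex_cst D distD p); apply: le_Ex => // r.
  rewrite -natrD ler1n addn_gt0 !lt0b /good.
  have [chiT|chiT] := eqVneq chi [set: 'I_m.+1]%SET.
    by case: r => [j|] //=; rewrite chiT finset.in_setT.
  case: r => [j|] /=; last first.
    apply: contraR chiT => /hasPn nchi; apply/eqP/setP => j.
    by rewrite finset.in_setT; apply/negPn/nchi; rewrite mem_enum.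
  have [jc|jc] := boolP (j \in chi); first by rewrite orbT.
  rewrite orbF; apply/andP; split.
    by apply: contra jc => /eqP /chi0.
  apply/forallP => i; apply/implyP => /eqP /chi0 /DP ->; rewrite (DQ _ jc).
  apply/eqP => QP; move: far; rewrite QP dTVxx leNgt.
  by case/andP: eps01 => ->.
by lra.
Qed.
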